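(* Assuming $\mathsf{DC}$ and $\mathsf{LEM}$, the downward Löwenheim–Skolem theorem $\mathsf{DLS}$ holds.
   Context: Meta-theory: higher-order logic with propositions $\mathbb P$ and $\mathbb N$. A type $A$ is countable if there are $i:A\to\mathbb N$, $j:\mathbb N\to A$ with $j(i\,x)=x$ (finite included). First-order logic without equality over signatures of function/relation symbols; formulas from $\dot\bot$, atoms, $\dot\to,\dot\land,\dot\lor,\dot\forall,\dot\exists$; models are types with interpretations of the symbols; $\mathcal M\vDash_\rho\phi$ is Tarski satisfaction for $\rho:\mathbb N\to\mathcal M$. An elementary embedding $h:\mathcal N\to\mathcal M$ satisfies $\mathcal N\vDash_\rho\phi\leftrightarrow\mathcal M\vDash_{h\circ\rho}\phi$ for all $\rho,\phi$. $\mathsf{DLS}$: for every signature with countably many symbols and every model $\mathcal M$, there are a model $\mathcal N$ with countable domain and an elementary embedding $\mathcal N\to\mathcal M$. - $\mathsf{LEM}$: $\forall p:\mathbb P.\,p\lor\neg p$. - $\mathsf{DC}$: for every inhabited $A$ and $R:A\to A\to\mathbb P$ with $\forall x\exists y.\,R\,x\,y$, there is $f:\mathbb N\to A$ with $\forall n.\,R(f\,n)(f(n+1))$.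
   Formalization: Models are assumed to be nonempty: with countability defined by maps i and j as above, a countable domain is always inhabited, so no countable model can map into an empty model and the claim would fail there. *)

(* Defs.v *)
From Stdlib Require Vector.

Set Implicit Arguments.
Unset Strict Implicit.

(* A type is exhibited as a retract of [nat].  This allows repetitions, hence
   finite types, but it forces the type to be inhabited (by [j 0]). *)
Definition countable (A : Type) : Prop :=
  exists (i : A -> nat) (j : nat -> A), forall x, j (i x) = x.

Definition LEM : Prop := forall p : Prop, p \/ ~ p.

Definition DC : Prop :=
  forall (A : Type) (R : A -> A -> Prop),
    inhabited A -> (forall x, exists y, R x y) ->
    exists f : nat -> A, forall n, R (f n) (f (S n)).

Record signature : Type := Signature {
  funs : Type;
  fun_arity : funs -> nat;
  rels : Type;
  rel_arity : rels -> nat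
}.

Definition symbols (S : signature) : Type := (funs S + rels S)%type.

(* The first disjunct admits the signature without symbols, which [countable]
   alone would exclude.  Taking the sum type admits signatures with only
   function symbols or only relation symbols. *)
Definition countable_signature (S : signature) : Prop :=
  (symbols S -> False) \/ countable (symbols S).

(* Variables are de Bruijn indices: [All] and [Ex] bind index 0 of their body. *)
Inductive term (S : signature) : Type :=
| Var : nat -> term S
| Fun : forall f : funs S, Vector.t (term S) (fun_arity f) -> term S.

Inductive form (S : signature) : Type :=
| Bot : form S
| Rel : forall r : rels S, Vector.t (term S) (rel_arity r) -> form S
| Imp : form S -> form S -> form S
| And : form S -> form S -> form S
| Or : form S -> form S -> form S
| All : form S -> form S
| Ex : form S -> form S.

Arguments Var {S} _.
Arguments Fun {S} f _.
Arguments Bot {S}.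
Arguments Rel {S} r _.

Record model (S : signature) : Type := Model {
  domain :> Type;
  fun_interp : forall f : funs S, Vector.t domain (fun_arity f) -> domain;
  rel_interp : forall r : rels S, Vector.t domain (rel_arity r) -> Prop
}.

Arguments fun_interp {S} m f _.
Arguments rel_interp {S} m r _.

Fixpoint eval (S : signature) (M : model S) (rho : nat -> M) (t : term S) : M :=
  match t with
  | Var n => rho n
  | Fun f v => fun_interp M f (Vector.map (eval rho) v)
  end.

Definition scons (A : Type) (a : A) (rho : nat -> A) (n : nat) : A :=
  match n with
  | O => a
  | S n => rho n
  end.

Fixpoint sat (S : signature) (M : model S) (rho : nat -> M) (phi : form S) : Prop :=
  match phi with
  | Bot => False
  | Rel r v => rel_interp M r (Vector.map (eval rho) v)
  | Imp phi psi => sat rho phi -> sat rho psi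
  | And phi psi => sat rho phi /\ sat rho psi
  | Or phi psi => sat rho phi \/ sat rho psi
  | All phi => forall a : M, sat (scons a rho) phi
  | Ex phi => exists a : M, sat (scons a rho) phi
  end.

Definition elementary_embedding (S : signature) (N M : model S) (h : N -> M) : Prop :=
  forall (rho : nat -> N) (phi : form S),
    sat rho phi <-> sat (fun n => h (rho n)) phi.

(* Following the usual convention for first-order models, [M] is assumed
   nonempty: nothing inhabited, hence nothing [countable], maps into an empty
   domain. *)
Definition DLS : Prop :=
  forall S : signature, countable_signature S ->
  forall M : model S, inhabited M ->
  exists (N : model S) (h : N -> M), countable N /\ elementary_embedding h.

(* Main.v *)
(** Since the logic has no equality, the submodel can be taken on the type of
    terms itself: given an environment [rho : nat -> M], interpret function
    symbols freely and pull the relations back along [eval rho].  Then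
    [eval rho] is elementary as soon as it satisfies the Tarski-Vaught test,
    i.e. every existential formula with parameters among the values of terms
    has, if any, a witness among the values of [rho].  There are countably many
    such conditions, each of which inspects only finitely many values of [rho],
    so [DC] yields [rho] by fixing one value after the other, the value at [n]
    serving as a witness for the [n]-th condition. *)
From Stdlib Require Import Vector Arith Lia Cantor.
Require Import Defs.

Definition agree_below {A : Type} (b : nat) (rho rho' : nat -> A) : Prop :=
  forall k, k < b -> rho k = rho' k.

(** * Generic sequences *)

(** A condition is settled as soon as the values it inspects are final: from then on it has the same
    truth value in every approximation and in the limit, so a witness chosen at such a stage stays a
    witness. *)
Lemma generic_sequence (A : Type) (P : nat -> (nat -> A) -> A -> Prop) :
  DC -> LEM -> inhabited A ->
  (forall i, exists b, forall rho rho', agree_below b rho rho' ->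
     forall a, P i rho a <-> P i rho' a) ->
  exists rho, forall i, (exists a, P i rho a) -> exists n, P i rho (rho n).
Proof.
  intros dc lem [a0] local.
  (* In a state [(n, rho)] the values of [rho] below [n] are final.  Condition
     [i] is treated at every [n] of the form [to_nat (i, _)], hence also after
     all the values it inspects have been fixed. *)
  pose (step := fun s s' : nat * (nat -> A) =>
    fst s' = S (fst s) /\ agree_below (fst s) (snd s) (snd s') /\
    let i := fst (of_nat (fst s)) in
    (exists a, P i (snd s) a) -> P i (snd s) (snd s' (fst s))).
  destruct (dc (nat * (nat -> A))%type step) as [f Hf].
  { exact (inhabits (0, fun _ => a0)). }
  { intros [n rho].
    set (i := fst (of_nat n)).
    (* [LEM] makes [step] total: [a0] is the default when the condition has no witness. *)
    assert (exists a, (exists a, P i rho a) -> P i rho a) as [a Ha].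
    { destruct (lem (exists a, P i rho a)) as [[a Ha]|no].
      - exists a; intros _; exact Ha.
      - exists a0; intros yes; destruct (no yes). }
    exists (S n, fun k => if k =? n then a else rho k); unfold step; cbn.
    split; [reflexivity|split].
    - intros k Hk; rewrite (proj2 (Nat.eqb_neq k n)); [reflexivity|lia].
    - rewrite Nat.eqb_refl; exact Ha. }
  (* [DC] does not prescribe [f 0], so the stages start at an unknown offset [fst (f 0)]. *)
  assert (Hfst : forall m, fst (f m) = m + fst (f 0)).
  { induction m as [|m IH]; [reflexivity|].
    destruct (Hf m) as [E _]; rewrite E, IH; reflexivity. }
  assert (Hstable : forall m d,
             agree_below (fst (f m)) (snd (f m)) (snd (f (d + m)))).
  { intros m d; induction d as [|d IH]; intros k Hk; [reflexivity|].
    destruct (Hf (d + m)) as (_ & E & _).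
    rewrite (IH k Hk); apply E.
    rewrite Hfst in *; lia. }
  (* Diagonal limit: the counter of [f (S k)] exceeds [k], so its value at [k] is final. *)
  pose (rho := fun k => snd (f (S k)) k).
  assert (Hrho : forall m, agree_below (fst (f m)) (snd (f m)) rho).
  { intros m k Hk; unfold rho.
    assert (k < fst (f (S k))) as Hk' by (rewrite Hfst; lia).
    destruct (Nat.le_ge_cases m (S k)) as [le|le].
    - rewrite (Hstable m (S k - m) k Hk); do 2 f_equal; lia.
    - rewrite (Hstable (S k) (m - S k) k Hk'); do 2 f_equal; lia. }
  exists rho; intros i [a Ha].
  destruct (local i) as [b Hb].
  (* This position treats condition [i] and is at least both [b] and the offset, so it is reached at
     stage [m] with the first [b] values final. *)
  set (n := to_nat (i, b + fst (f 0))).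
  assert (b + fst (f 0) <= n) as Hn
    by (pose proof (to_nat_non_decreasing i (b + fst (f 0))); lia).
  set (m := n - fst (f 0)).
  assert (fst (f m) = n) as Em by (rewrite Hfst; lia).
  assert (forall a, P i (snd (f m)) a <-> P i rho a) as Hi.
  { apply Hb; intros k Hk; apply Hrho; lia. }
  exists n.
  destruct (Hf m) as (E & _ & Hw).
  cbv zeta in Hw; rewrite Em in Hw; unfold n in Hw at 1 2.
  rewrite cancel_of_to in Hw; cbn [fst] in Hw.
  assert (snd (f (S m)) n = rho n) as <- by (apply Hrho; rewrite E; lia).
  apply Hi, Hw.
  exists a; apply Hi, Ha.
Qed.

(** * Codes of terms and formulas *)

(** Iterated unpairing reads a number as an infinite sequence, so codes of finite prefixes need no
    length. *)
Fixpoint nat_seq (c k : nat) : nat :=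
  match k with
  | 0 => fst (of_nat c)
  | S k => nat_seq (snd (of_nat c)) k
  end.

Lemma nat_seq_prefix (b : nat) (s : nat -> nat) :
  exists c, agree_below b (nat_seq c) s.
Proof.
  revert s; induction b as [|b IH]; intros s.
  - exists 0; intros k Hk; lia.
  - destruct (IH (fun k => s (S k))) as [c Hc].
    exists (to_nat (s 0, c)); intros [|k] Hk; cbn [nat_seq];
      rewrite cancel_of_to; [reflexivity|].
    apply Hc; lia.
Qed.

Section VectorCode.
  Context {A : Type}.

  (** [code] is bound outside the [fix], which lets [term_code] recurse structurally through the
      vector. *)
  Definition vector_code (code : A -> nat) : forall n, Vector.t A n -> nat :=
    fix vector_code n v :=
      match v with
      | Vector.nil _ => 0
      | Vector.cons _ x _ v => to_nat (code x, vector_code _ v)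
      end.

  Fixpoint vector_decode (decode : nat -> A) (n c : nat) : Vector.t A n :=
    match n with
    | 0 => Vector.nil A
    | S n => Vector.cons A (decode (fst (of_nat c))) n
                         (vector_decode decode n (snd (of_nat c)))
    end.

  (** Pairing dominates its components, so no entry has a code above that of the vector. Correctness
      of [decode] up to this bound is what a decoder with limited fuel can offer. *)
  Lemma vector_decode_code code decode n (v : Vector.t A n) :
    Vector.Forall
      (fun x => code x <= vector_code code _ v -> decode (code x) = x) v ->
    vector_decode decode n (vector_code code _ v) = v.
  Proof.
    (* The bound is fixed as [b] because the code of the vector shrinks along the induction. *)
    enough (H : forall b, vector_code code _ v <= b ->
      Vector.Forall (fun x => code x <= b -> decode (code x) = x) v ->
      vector_decode decode n (vector_code code _ v) = v) by (apply H; auto).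
    intros b Hb H; induction H as [|n x v Hx _ IH];
      cbn [vector_code vector_decode] in *; [reflexivity|].
    pose proof (to_nat_non_decreasing (code x) (vector_code code _ v)).
    rewrite cancel_of_to; cbn [fst snd].
    rewrite Hx, IH by lia; reflexivity.
  Qed.
End VectorCode.

Lemma term_vector_ind (S : signature) (P : term S -> Prop) :
  (forall n, P (Var n)) ->
  (forall f v, Vector.Forall P v -> P (Fun f v)) ->
  forall t, P t.
Proof.
  intros HVar HFun; fix IH 1; intros [n|f v]; [apply HVar|apply HFun].
  induction v as [|x n v IHv]; constructor; [apply IH|exact IHv].
Qed.

Section Code.
  (** A partial inverse also covers the signature without symbols. *)
  Context {S : signature} (sym : symbols S -> nat)
          (sym_inv : nat -> option (symbols S))
          (sym_invK : forall s, sym_inv (sym s) = Some s).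

  Fixpoint term_code (t : term S) : nat :=
    match t with
    | Var n => to_nat (0, n)
    | Fun f v => to_nat (1 + sym (inl f), vector_code term_code _ v)
    end.

  (* The first argument bounds the recursion depth; it suffices that it
     exceeds the code. *)
  Fixpoint term_decode (fuel c : nat) : term S :=
    match fuel, of_nat c with
    | Datatypes.S fuel, (Datatypes.S s, c) =>
        match sym_inv s with
        | Some (inl f) => Fun f (vector_decode (term_decode fuel) _ c)
        | _ => Var 0
        end
    | _, (_, n) => Var n
    end.

  (** The nonzero tag of [Fun] puts the code of a term strictly above those of its arguments, so one
      unit of fuel per level suffices. *)
  Lemma term_decode_code (t : term S) (fuel : nat) :
    term_code t < fuel -> term_decode fuel (term_code t) = t.
  Proof.
    revert fuel; induction t as [n|f v IH] using term_vector_ind;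
      intros [|fuel] Hfuel; try lia; cbn [term_decode term_code] in *;
      rewrite cancel_of_to; [reflexivity|].
    cbn [Nat.add]; rewrite sym_invK; f_equal.
    apply vector_decode_code.
    pose proof (to_nat_non_decreasing (1 + sym (inl f))
                                      (vector_code term_code _ v)).
    apply Vector.Forall_impl with (2 := IH).
    intros x Hx Hle; apply Hx; lia.
  Qed.

  Lemma term_countable : countable (term S).
  Proof.
    exists term_code, (fun c => term_decode (1 + c) c); intros t.
    apply term_decode_code; lia.
  Qed.

  Fixpoint form_code (phi : form S) : nat :=
    match phi with
    | Bot => to_nat (0, 0)
    | Imp phi psi => to_nat (1, to_nat (form_code phi, form_code psi))
    | And phi psi => to_nat (2, to_nat (form_code phi, form_code psi))
    | Or phi psi => to_nat (3, to_nat (form_code phi, form_code psi))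
    | All phi => to_nat (4, form_code phi)
    | Ex phi => to_nat (5, form_code phi)
    | Rel r v => to_nat (6 + sym (inr r), vector_code term_code _ v)
    end.

  Fixpoint form_decode (fuel c : nat) : form S :=
    match fuel with
    | 0 => Bot
    | Datatypes.S fuel =>
        let c' := snd (of_nat c) in
        let dec := form_decode fuel in
        let left := dec (fst (of_nat c')) in
        let right := dec (snd (of_nat c')) in
        match fst (of_nat c) with
        | 0 => Bot
        | 1 => Imp left right
        | 2 => And left right
        | 3 => Or left right
        | 4 => All (dec c')
        | 5 => Ex (dec c')
        | Datatypes.S (Datatypes.S (Datatypes.S (Datatypes.S
            (Datatypes.S (Datatypes.S s))))) =>
            match sym_inv s with
            | Some (inr r) =>
                Rel r (vector_decode (fun c => term_decode (1 + c) c) _ c')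
            | _ => Bot
            end
        end
    end.

  Lemma form_decode_code (phi : form S) (fuel : nat) :
    form_code phi < fuel -> form_decode fuel (form_code phi) = phi.
  Proof.
    assert (Hpair : forall a x y,
      x + y < to_nat (1 + a, to_nat (x, y))).
    { intros a x y.
      pose proof (to_nat_non_decreasing (1 + a) (to_nat (x, y))).
      pose proof (to_nat_non_decreasing x y); lia. }
    assert (Hone : forall a x, x < to_nat (1 + a, x)).
    { intros a x; pose proof (to_nat_non_decreasing (1 + a) x); lia. }
    revert fuel; induction phi as
      [|r v|phi IH1 psi IH2|phi IH1 psi IH2|phi IH1 psi IH2|phi IH|phi IH];
      intros [|fuel] Hfuel; try lia; cbn [form_decode form_code] in *;
      cbv zeta; rewrite !cancel_of_to; cbn [fst snd Nat.add];
      rewrite ?cancel_of_to; cbn [fst snd].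
    - reflexivity.
    - rewrite sym_invK; f_equal.
      apply vector_decode_code.
      (* Each argument is decoded with fuel computed from its own code, independently of [fuel]. *)
      clear Hfuel; induction v as [|x n v IHv]; constructor.
      + intros _; apply term_decode_code; lia.
      + apply Vector.Forall_impl with (2 := IHv).
        intros y _ _; apply term_decode_code; lia.
    - pose proof (Hpair 0 (form_code phi) (form_code psi)); cbn [Nat.add] in *.
      rewrite IH1, IH2 by lia; reflexivity.
    - pose proof (Hpair 1 (form_code phi) (form_code psi)); cbn [Nat.add] in *.
      rewrite IH1, IH2 by lia; reflexivity.
    - pose proof (Hpair 2 (form_code phi) (form_code psi)); cbn [Nat.add] in *.
      rewrite IH1, IH2 by lia; reflexivity.
    - pose proof (Hone 3 (form_code phi)); cbn [Nat.add] in *.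
      rewrite IH by lia; reflexivity.
    - pose proof (Hone 4 (form_code phi)); cbn [Nat.add] in *.
      rewrite IH by lia; reflexivity.
  Qed.

  Lemma form_countable : countable (form S).
  Proof.
    exists form_code, (fun c => form_decode (1 + c) c); intros phi.
    apply form_decode_code; lia.
  Qed.
End Code.

Lemma countable_syntax (S : signature) :
  countable_signature S -> countable (term S) /\ countable (form S).
Proof.
  intros [empty|(i & j & ij)].
  - assert (H : forall s : symbols S, @None (symbols S) = Some s)
      by (intros s; destruct (empty s)).
    split.
    + exact (term_countable (fun _ => 0) (fun _ => None) H).
    + exact (form_countable (fun _ => 0) (fun _ => None) H).
  - assert (H : forall s, Some (j (i s)) = Some s)
      by (intros s; rewrite ij; reflexivity).
    split.
    + exact (term_countable i (fun n => Some (j n)) H).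
    + exact (form_countable i (fun n => Some (j n)) H).
Qed.

(** * Dependence on finitely many variables *)

Lemma agree_below_le {A : Type} (b b' : nat) (rho rho' : nat -> A) :
  b <= b' -> agree_below b' rho rho' -> agree_below b rho rho'.
Proof. intros Hb H k Hk; apply H; lia. Qed.

(** Keeping the same [b] lets a quantified formula inherit the bound of its body. *)
Lemma agree_below_scons {A : Type} (b : nat) (a : A) (rho rho' : nat -> A) :
  agree_below b rho rho' -> agree_below b (scons a rho) (scons a rho').
Proof. intros H [|k] Hk; cbn; [reflexivity|apply H; lia]. Qed.

Section Local.
  Context {S : signature} {M : model S}.

  Lemma vector_eval_local n (v : Vector.t (term S) n) :
    Vector.Forall (fun t => exists b, forall rho rho' : nat -> M,
      agree_below b rho rho' -> eval rho t = eval rho' t) v ->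
    exists b, forall rho rho' : nat -> M, agree_below b rho rho' ->
      Vector.map (eval rho) v = Vector.map (eval rho') v.
  Proof.
    intros H; induction H as [|n t v [b Hb] _ [b' Hb']].
    - exists 0; reflexivity.
    - exists (max b b'); intros rho rho' H; cbn; f_equal.
      + apply Hb, agree_below_le with (2 := H); lia.
      + apply Hb', agree_below_le with (2 := H); lia.
  Qed.

  Lemma eval_local (t : term S) :
    exists b, forall rho rho' : nat -> M,
      agree_below b rho rho' -> eval rho t = eval rho' t.
  Proof.
    induction t as [n|f v IH] using term_vector_ind.
    - exists (1 + n); intros rho rho' H; apply H; lia.
    - destruct (vector_eval_local _ _ IH) as [b Hb].
      exists b; intros rho rho' H; cbn; f_equal; apply Hb, H.
  Qed.

  Lemma sat_local (phi : form S) :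
    exists b, forall rho rho' : nat -> M,
      agree_below b rho rho' -> (sat rho phi <-> sat rho' phi).
  Proof.
    induction phi as
      [|r v|phi [b Hb] psi [b' Hb']|phi [b Hb] psi [b' Hb']
       |phi [b Hb] psi [b' Hb']|phi [b Hb]|phi [b Hb]].
    - exists 0; reflexivity.
    - destruct (vector_eval_local _ v) as [b Hb].
      { apply Vector.Forall_forall; intros t _; apply eval_local. }
      exists b; intros rho rho' H; cbn; rewrite (Hb _ _ H); reflexivity.
    - exists (max b b'); intros rho rho' H; cbn.
      rewrite (Hb rho rho'), (Hb' rho rho');
        [reflexivity|apply agree_below_le with (2 := H); lia..].
    - exists (max b b'); intros rho rho' H; cbn.
      rewrite (Hb rho rho'), (Hb' rho rho');
        [reflexivity|apply agree_below_le with (2 := H); lia..].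
    - exists (max b b'); intros rho rho' H; cbn.
      rewrite (Hb rho rho'), (Hb' rho rho');
        [reflexivity|apply agree_below_le with (2 := H); lia..].
    - exists b; intros rho rho' H; cbn.
      split; intros Ha a; apply (Hb (scons a rho) (scons a rho'));
        auto using agree_below_scons.
    - exists b; intros rho rho' H; cbn.
      split; intros [a Ha]; exists a;
        apply (Hb (scons a rho) (scons a rho'));
        auto using agree_below_scons.
  Qed.

  (** Takes the place of functional extensionality for environments. *)
  Lemma sat_ext (phi : form S) (rho rho' : nat -> M) :
    (forall k, rho k = rho' k) -> (sat rho phi <-> sat rho' phi).
  Proof.
    intros H; destruct (sat_local phi) as [b Hb].
    apply Hb; intros k _; apply H.
  Qed.

  (** Only the terms [sigma 0], ..., [sigma (b - 1)] matter, and each inspects finitely many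
      values. *)
  Lemma substitution_local (sigma : nat -> term S) (b : nat) :
    exists b', forall rho rho' : nat -> M, agree_below b' rho rho' ->
      agree_below b (fun k => eval rho (sigma k)) (fun k => eval rho' (sigma k)).
  Proof.
    induction b as [|b [b1 H1]].
    - exists 0; intros rho rho' _ k Hk; lia.
    - destruct (eval_local (sigma b)) as [b2 H2].
      exists (max b1 b2); intros rho rho' H k Hk.
      destruct (Nat.eq_dec k b) as [->|ne].
      + apply H2, agree_below_le with (2 := H); lia.
      + apply (H1 rho rho'); [apply agree_below_le with (2 := H)|]; lia.
  Qed.
End Local.

(** * The term model *)

Definition term_model {S : signature} (M : model S) (rho : nat -> M) : model S :=
  {| domain := term S;
     fun_interp := @Fun S;
     rel_interp r v := rel_interp M r (Vector.map (eval rho) v) |}.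

Section TermModel.
  Context {S : signature} {M : model S} (rho : nat -> M).

  (** Evaluation in the term model is substitution, so this is the substitution lemma for terms. *)
  Lemma eval_term_model (sigma : nat -> term_model M rho) (t : term S) :
    eval rho (eval sigma t) = eval (fun k => eval rho (sigma k)) t.
  Proof.
    induction t as [n|f v IH] using term_vector_ind; cbn; [reflexivity|].
    f_equal; induction IH as [|t n v Ht _ IHv]; cbn; [reflexivity|].
    f_equal; assumption.
  Qed.

  Definition tarski_vaught : Prop :=
    forall (phi : form S) (sigma : nat -> term S),
      (exists a, sat (scons a (fun k => eval rho (sigma k))) phi) ->
      exists t, sat (scons (eval rho t) (fun k => eval rho (sigma k))) phi.

  Lemma tarski_vaught_elementary :
    LEM -> tarski_vaught ->
    @elementary_embedding S (term_model M rho) M (eval rho).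
  Proof.
    intros lem tv sigma phi; revert sigma.
    assert (Hcons : forall phi t (sigma : nat -> term_model M rho),
      sat (fun k => eval rho (scons t sigma k)) phi <->
      sat (scons (eval rho t) (fun k => eval rho (sigma k))) phi).
    { intros; apply sat_ext; intros [|k]; reflexivity. }
    induction phi as
      [|r v|phi IH1 psi IH2|phi IH1 psi IH2|phi IH1 psi IH2|phi IH|phi IH];
      intros sigma; cbn.
    - reflexivity.
    - rewrite Vector.map_map, (Vector.map_ext _ _ _ _ (eval_term_model sigma)).
      reflexivity.
    - rewrite IH1, IH2; reflexivity.
    - rewrite IH1, IH2; reflexivity.
    - rewrite IH1, IH2; reflexivity.
    - split; intros H.
      + intros a.
        destruct (lem (sat (scons a (fun k => eval rho (sigma k))) phi))
          as [yes|no]; [exact yes|exfalso].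
        (* A counterexample to [phi] is a witness of its negation, to which the test applies. *)
        destruct (tv (Imp phi Bot) sigma) as [t Ht]; [exists a; exact no|].
        apply Ht, Hcons, IH, H.
      + intros t; apply IH, Hcons, H.
    - split; intros H.
      + destruct H as [t Ht]; exists (eval rho t).
        apply Hcons, IH, Ht.
      + destruct (tv phi sigma H) as [t Ht]; exists t.
        apply IH, Hcons, Ht.
  Qed.
End TermModel.

Lemma tarski_vaught_exists (S : signature) (M : model S) :
  DC -> LEM -> countable_signature S -> inhabited M ->
  exists rho : nat -> M, tarski_vaught rho.
Proof.
  intros dc lem cS inh.
  destruct (countable_syntax S cS) as [(it & jt & ijt) (iF & jF & ijF)].
  pose (form_of := fun i => jF (fst (of_nat i))).
  pose (subst_of := fun i k => jt (nat_seq (snd (of_nat i)) k)).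
  destruct (generic_sequence M
    (fun i rho a =>
       sat (scons a (fun k => eval rho (subst_of i k))) (form_of i)))
    as [rho Hrho]; auto.
  { intros i.
    destruct (sat_local (M := M) (form_of i)) as [b Hb].
    destruct (substitution_local (M := M) (subst_of i) b) as [b' Hb'].
    exists b'; intros rho rho' H a.
    apply Hb, agree_below_scons, Hb', H. }
  exists rho; intros phi sigma.
  destruct (sat_local (M := M) phi) as [b Hb].
  (* Substitutions as a whole cannot be enumerated, but [phi] sees only the first [b] terms of
     [sigma], which a single number [c] encodes. *)
  destruct (nat_seq_prefix b (fun k => it (sigma k))) as [c Hc].
  specialize (Hrho (to_nat (iF phi, c))); cbv beta in Hrho.
  unfold form_of, subst_of in Hrho.
  rewrite cancel_of_to in Hrho; cbn [fst snd] in Hrho; rewrite ijF in Hrho.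
  assert (E : forall a,
    sat (scons a (fun k => eval rho (jt (nat_seq c k)))) phi <->
    sat (scons a (fun k => eval rho (sigma k))) phi).
  { intros a; apply Hb, agree_below_scons; intros k Hk.
    rewrite (Hc k Hk), ijt; reflexivity. }
  intros [a Ha].
  destruct Hrho as [n Hn]; [exists a; apply E, Ha|].
  (* The witness [rho n] is the value of the variable [n]. *)
  exists (Var n); apply E, Hn.
Qed.

Theorem theorem4p1 : DC -> LEM -> DLS.
Proof.
  intros dc lem S cS M inh.
  destruct (tarski_vaught_exists S M dc lem cS inh) as [rho Hrho].
  exists (term_model M rho), (eval rho); split.
  - exact (proj1 (countable_syntax S cS)).
  - apply tarski_vaught_elementary; assumption.
Qed.
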